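(* Let $V$ be a Hilbert module over the Clifford algebra $\mathbb{R}_d$ and let $T\in\mathcal{K}(V)$ be a densely defined closed right-linear operator with adjoint $T^*$. Then $$\sigma_S(T^* )=\sigma_S(T).$$ Moreover, for every $s\in\rho_S(T^* )$, the $S$-resolvent operators of $T^*$ are given by $$S_L^{-1}(s,T^* )=S_R^{-1}(\overline{s},T)^*\qquad\text{and}\qquad S_R^{-1}(s,T^* )=S_L^{-1}(\overline{s},T)^*.$$
   Context: Clifford algebra: for $d\in\mathbb{N}$, $d\ge1$, $\mathbb{R}_d$ is the real Clifford algebra generated by imaginary units $e_1,\dots,e_d$ with $e_i^2=-1$ and $e_ie_j=-e_je_i$ for $i\neq j$, with real basis $e_A=e_{i_1}\cdots e_{i_r}$, $A=(i_1,\dots,i_r)$, $1\le i_1<\dots<i_r\le d$, $e_\emptyset=1$. For $s=\sum_As_Ae_A$: $\overline{s}=\sum_A(-1)^{|A|(|A|+1)/2}s_Ae_A$, $|s|^2=\sum_As_A^2$, $\operatorname{Sc}(s)=s_\emptyset$. Paravectors: $\mathbb{R}^{d+1}=\{s_0+s_1e_1+\dots+s_de_d\mid s_j\in\mathbb{R}\}$. Hilbert module: for a real Hilbert space $V_\mathbb{R}$, $V=\{\sum_Av_A\otimes e_A\mid v_A\in V_\mathbb{R}\}$ with norm $\|v\|^2=\sum_A\|v_A\|_\mathbb{R}^2$, scalar multiplications $sv=\sum_{A,B}(s_Bv_A)\otimes(e_Be_A)$, $vs=\sum_{A,B}(v_As_B)\otimes(e_Ae_B)$, and $\mathbb{R}_d$-valued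 inner product $\langle v,w\rangle=\sum_{A,B}\langle v_A,w_B\rangle_\mathbb{R}\overline{e_A}e_B$. Operators: $\mathcal{B}(V)$ is the set of bounded everywhere defined right-linear operators on $V$, $\mathcal{K}(V)$ the set of closed right-linear operators $T:\operatorname{dom}(T)\subseteq V\to V$ (domain a right submodule). The adjoint of a densely defined right-linear $T$ is the right-linear operator $T^*$ with $\operatorname{dom}(T^* )=\{w\in V\mid\exists v_w\in V:\langle v_w,v\rangle=\langle w,Tv\rangle\text{ for all }v\in\operatorname{dom}(T)\}$ and $T^*w=v_w$. Products of operators with Clifford numbers are $(sT)v=s(Tv)$, $(Ts)v=T(sv)$ (left multiplication). For $s\in\mathbb{R}^{d+1}$, $Q_s[T]:=T^2-2s_0T+|s|^2$ with $\operatorname{dom}(Q_s[T])=\operatorname{dom}(T^2)$. $\rho_S(T)=\{s\in\mathbb{R}^{d+1}\mid Q_s[T]^{-1}\in\mathcal{B}(V)\}$, $\sigma_S(T)=\mathbb{R}^{d+1}\setminus\rho_S(T)$. For $s\in\rho_S(T)$: $S_L^{-1}(s,T)=Q_s[T]^{-1}\overline{s}-TQ_s[T]^{-1}$ and $S_R^{-1}(s,T)=(\overline{s}-T)Q_s[T]^{-1}$. *)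

(* Defs.v *)
From HB Require Import structures.
From mathcomp Require Import all_boot all_order all_algebra.
From mathcomp Require Import all_classical all_reals all_analysis.
From mathcomp Require Import ring.
Set Implicit Arguments.
Unset Strict Implicit.
Unset Printing Implicit Defensive.
Import Order.TTheory GRing.Theory Num.Theory.
Import numFieldNormedType.Exports.
Local Open Scope classical_set_scope.
Local Open Scope ring_scope.

(* The Clifford algebra R_d is realised on coordinate families (s_A), the
   increasing multi-index A being a subset of 'I_d.  Moving the factors of
   e_A e_B into increasing order and cancelling the repeated ones gives
   e_A e_B = (-1)^n e_(A symmetric difference B), where n counts the pairs
   (i, j) in A x B with j <= i: one transposition when j < i, and one
   relation e_i ^ 2 = -1 when j = i.
   The lemmas clifford_sqr, clifford_anticomm and clifford_basisE below show
   that this is the algebra presented by the usual generators and relations. *)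
Section Clifford.
Variables (R : comNzRingType) (d : nat).

Definition clifford : Type := {ffun {set 'I_d} -> R^o}.

HB.instance Definition _ := GRing.Lmodule.copy clifford {ffun {set 'I_d} -> R^o}.
HB.instance Definition _ := Choice.copy clifford {ffun {set 'I_d} -> R^o}.

Implicit Types (x y z : clifford) (A B C : {set 'I_d}).

Definition ccoef x A : R := (x : {ffun {set 'I_d} -> R^o}) A.

Definition cbasis A : clifford := [ffun B => (B == A)%:R].

Definition cgen (i : 'I_d) : clifford := cbasis [set i]%SET.

Definition symdiff A B : {set 'I_d} := ((A :\: B) :|: (B :\: A))%SET.

Definition csign A B : R :=
  (-1) ^+ (\sum_(i in A) \sum_(j in B) (j <= i : nat))%N.

Definition cmul x y : clifford :=
  \sum_A \sum_B (ccoef x A * ccoef y B * csign A B) *: cbasis (symdiff A B).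

Definition cone : clifford := cbasis finset.set0.

Lemma cliffordP x y : (forall A, ccoef x A = ccoef y A) -> x = y.
Proof. by move=> h; apply/ffunP. Qed.

Lemma ccoefD x y A : ccoef (x + y) A = ccoef x A + ccoef y A.
Proof. by rewrite /ccoef ffunE. Qed.

Lemma ccoefZ a x A : ccoef (a *: x) A = a * ccoef x A.
Proof. by rewrite /ccoef ffunE. Qed.

Lemma ccoef0 A : ccoef 0 A = 0.
Proof. by rewrite /ccoef ffunE. Qed.

Lemma ccoef_sum (I : finType) (F : I -> clifford) A :
  ccoef (\sum_i F i) A = \sum_i ccoef (F i) A.
Proof.
exact: (big_morph (fun x => ccoef x A) (fun x y => ccoefD x y A) (ccoef0 A)).
Qed.

Lemma ccoef_basis A B : ccoef (cbasis A) B = (B == A)%:R.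
Proof. by rewrite /ccoef ffunE. Qed.

Lemma clifford_expand x : x = \sum_A ccoef x A *: cbasis A.
Proof.
apply: cliffordP => B; rewrite ccoef_sum (bigD1 B) //= ccoefZ ccoef_basis eqxx.
rewrite mulr1 big1 ?addr0 // => A AB.
by rewrite ccoefZ ccoef_basis eq_sym (negPf AB) mulr0.
Qed.

Let linear_ext (f g : clifford -> clifford) :
  {morph f : x y / x + y} -> (forall a x, f (a *: x) = a *: f x) ->
  {morph g : x y / x + y} -> (forall a x, g (a *: x) = a *: g x) ->
  (forall A, f (cbasis A) = g (cbasis A)) -> f =1 g.
Proof.
move=> fD fZ gD gZ fg x; rewrite (clifford_expand x).
have f0 : f 0 = 0 by rewrite -[0 in LHS](scale0r (0 : clifford)) fZ scale0r.
have g0 : g 0 = 0 by rewrite -[0 in LHS](scale0r (0 : clifford)) gZ scale0r.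
rewrite (big_morph f fD f0) (big_morph g gD g0).
by apply: eq_bigr => A _; rewrite fZ gZ fg.
Qed.

Let cmulDl x y z : cmul (x + y) z = cmul x z + cmul y z.
Proof.
rewrite /cmul -big_split; apply: eq_bigr => A _ /=; rewrite -big_split.
by apply: eq_bigr => B _ /=; rewrite ccoefD !mulrDl scalerDl.
Qed.

Let cmulDr x y z : cmul x (y + z) = cmul x y + cmul x z.
Proof.
rewrite /cmul -big_split; apply: eq_bigr => A _ /=; rewrite -big_split.
by apply: eq_bigr => B _ /=; rewrite ccoefD mulrDr !mulrDl scalerDl.
Qed.

Let cmulZl a x y : cmul (a *: x) y = a *: cmul x y.
Proof.
rewrite /cmul scaler_sumr; apply: eq_bigr => A _; rewrite scaler_sumr.
by apply: eq_bigr => B _; rewrite ccoefZ scalerA !mulrA.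
Qed.

Let cmulZr a x y : cmul x (a *: y) = a *: cmul x y.
Proof.
rewrite /cmul scaler_sumr; apply: eq_bigr => A _; rewrite scaler_sumr.
by apply: eq_bigr => B _; rewrite ccoefZ scalerA (mulrCA _ a) !mulrA.
Qed.

Let cmul_basis A B :
  cmul (cbasis A) (cbasis B) = csign A B *: cbasis (symdiff A B).
Proof.
rewrite /cmul (bigD1 A) //= (bigD1 B) //= !ccoef_basis !eqxx !mul1r.
rewrite big1 ?addr0 => [|C CB]; last first.
  by rewrite ccoef_basis (negPf CB) mulr0 mul0r scale0r.
rewrite big1 ?addr0 // => C CA; rewrite big1 // => D _.
by rewrite ccoef_basis (negPf CA) !mul0r scale0r.
Qed.

Let prod_symdiff (g : 'I_d -> R) A B : (forall i, g i * g i = 1) ->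
  \prod_(i in symdiff A B) g i = (\prod_(i in A) g i) * \prod_(i in B) g i.
Proof.
move=> gg; rewrite big_mkcond [X in _ = X * _]big_mkcond.
rewrite [X in _ = _ * X]big_mkcond -big_split; apply: eq_bigr => i _ /=.
by rewrite !inE; case: (i \in A); case: (i \in B); rewrite /= ?gg ?mulr1 ?mul1r.
Qed.

Let signK n : ((-1) ^+ n * (-1) ^+ n = 1 :> R).
Proof. by rewrite -exprD addnn -signr_odd odd_double. Qed.

Let csign_symdiffl A B C : csign (symdiff A B) C = csign A C * csign B C.
Proof. rewrite /csign -!prodrXr; apply: prod_symdiff => i; exact: signK. Qed.

Let csign_symdiffr A B C : csign A (symdiff B C) = csign A B * csign A C.
Proof.
rewrite /csign -!prodrXr -big_split; apply: eq_bigr => i _ /=.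
rewrite -!prodrXr; apply: prod_symdiff => j; exact: signK.
Qed.

Let symdiffA A B C : symdiff A (symdiff B C) = symdiff (symdiff A B) C.
Proof.
by apply/setP => i; rewrite !inE; case: (i \in A); case: (i \in B);
  case: (i \in C).
Qed.

Let cmul_basisA A B C :
  cmul (cbasis A) (cmul (cbasis B) (cbasis C)) =
  cmul (cmul (cbasis A) (cbasis B)) (cbasis C).
Proof.
rewrite !cmul_basis cmulZl cmulZr !cmul_basis !scalerA symdiffA.
by congr (_ *: _); rewrite csign_symdiffl csign_symdiffr mulrC mulrA.
Qed.

Fact cmulA : associative cmul.
Proof.
move=> x y z.
apply: (@linear_ext (fun x => cmul x (cmul y z)) (fun x => cmul (cmul x y) z));
  try by move=> *; rewrite ?(cmulDl, cmulZl).
move=> A; apply: (@linear_ext (fun y => cmul (cbasis A) (cmul y z))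
  (fun y => cmul (cmul (cbasis A) y) z));
  try by move=> *; rewrite ?(cmulDl, cmulZl) ?(cmulDr, cmulZr) ?(cmulDl, cmulZl).
move=> B; apply: (@linear_ext (fun z => cmul (cbasis A) (cmul (cbasis B) z))
  (fun z => cmul (cmul (cbasis A) (cbasis B)) z));
  by move=> *; rewrite ?(cmulDr, cmulZr) ?(cmulDr, cmulZr) ?cmul_basisA.
Qed.

Fact cmul1l : left_id cone cmul.
Proof.
apply: (@linear_ext (cmul cone) id) => // A.
by rewrite cmul_basis /csign big_set0 expr0 scale1r /symdiff finset.set0D finset.setD0 finset.set0U.
Qed.

Fact cmul1r : right_id cone cmul.
Proof.
apply: (@linear_ext (cmul^~ cone) id) => // A.
rewrite cmul_basis /csign big1 ?expr0 ?scale1r => [|i _]; last by rewrite big_set0.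
by rewrite /symdiff finset.set0D finset.setD0 finset.setU0.
Qed.

Fact cone_neq0 : cone != 0.
Proof.
apply/eqP => /(congr1 (fun x => ccoef x finset.set0)).
by rewrite ccoef_basis ccoef0 eqxx; apply/eqP; rewrite oner_eq0.
Qed.

HB.instance Definition _ := GRing.Zmodule_isNzRing.Build clifford
  cmulA cmul1l cmul1r cmulDl cmulDr cone_neq0.
HB.instance Definition _ := GRing.Lmodule_isLalgebra.Build R clifford
  (fun a x y => esym (cmulZl a x y)).
HB.instance Definition _ := GRing.Lalgebra_isAlgebra.Build R clifford
  (fun a x y => esym (cmulZr a x y)).

Lemma cbasisM A B : cbasis A * cbasis B = csign A B *: cbasis (symdiff A B).
Proof. exact: cmul_basis. Qed.

Lemma clifford_sqr i : cgen i * cgen i = -1.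
Proof.
rewrite cbasisM /csign !big_set1 leqnn expr1 /symdiff finset.setDv finset.setU0.
by rewrite scaleN1r.
Qed.

Lemma clifford_anticomm i j : i != j -> cgen i * cgen j = - (cgen j * cgen i).
Proof.
move=> ij; rewrite !cbasisM /csign !big_set1 /symdiff finset.setUC -scaleNr.
congr (_ *: _); case: (ltngtP i j) => [_|_|/val_inj/eqP]; rewrite ?(negPf ij) //.
by rewrite expr0 expr1 opprK.
Qed.

(* [enum A] lists A in increasing order *)
Lemma clifford_basisE A : cbasis A = \prod_(i <- enum A) cgen i.
Proof.
have sA : sorted (fun i j : 'I_d => i < j)%N (enum A).
  rewrite {1}/enum_mem; apply: sorted_filter; first by move=> i j k; exact: ltn_trans.
  have : sorted ltn (map val (enum 'I_d)) by rewrite val_enum_ord iota_ltn_sorted.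
  by rewrite -enumT sorted_map.
have trs : transitive (fun i j : 'I_d => i < j)%N by move=> i j k; exact: ltn_trans.
have {1}-> : A = [set i in enum A]%SET.
  by apply/setP => i; rewrite inE mem_enum.
move: (enum A) sA => {A} s; elim: s => [_|i s IH /= pis].
  rewrite big_nil -[RHS]/(cbasis finset.set0); apply: (congr1 cbasis).
  by apply/setP => i; rewrite !inE.
rewrite big_cons -IH ?(path_sorted pis) //.
have /allP lts := order_path_min trs pis.
rewrite cbasisM /csign big_set1 big1 ?expr0 ?scale1r => [|j]; last first.
  by rewrite inE => /lts; rewrite ltnNge => /negPf ->.
apply: (congr1 cbasis); apply/setP => j; rewrite !inE.
by case: eqP => [->|_] /=; [case: (boolP (i \in s)) => // /lts; rewrite ltnn|case: (j \in s)].
Qed.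

Definition cconj x : clifford :=
  \sum_(A : {set 'I_d}) ((-1) ^+ (#|A| * #|A|.+1)./2 * ccoef x A) *: cbasis A.

Definition Sc x : R := ccoef x finset.set0.

Definition cnormsq x : R := \sum_A ccoef x A ^+ 2.

Definition paravector : set clifford :=
  [set s | exists (s0 : R) (c : 'I_d -> R), s = s0%:A + \sum_i c i *: cgen i].

End Clifford.

Arguments cbasis {R d} A.
Arguments cgen {R d} i.
Arguments paravector {R d}.

HB.mixin Record NormedModule_hasInner (R : realType) V of NormedModule R V := {
  inner : V -> V -> R;
  innerC : forall x y, inner x y = inner y x;
  innerDl : forall x y z, inner (x + y) z = inner x z + inner y z;
  innerZl : forall a x y, inner (a *: x) y = a * inner x y;
  innerxx : forall x, inner x x = `|x| ^+ 2
}.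

#[short(type="hilbertType")]
HB.structure Definition Hilbert (R : realType) :=
  {V of CompleteNormedModule R V & NormedModule_hasInner R V}.

(* The module V (x) R_d: the family (v_A) stands for \sum_A v_A (x) e_A. *)
Section HilbertModule.
Variables (R : realType) (d : nat) (VR : hilbertType R).

Definition hmodule : Type := {ffun {set 'I_d} -> VR}.

HB.instance Definition _ := GRing.Lmodule.copy hmodule {ffun {set 'I_d} -> VR}.
HB.instance Definition _ := Choice.copy hmodule {ffun {set 'I_d} -> VR}.

Implicit Types (v w : hmodule) (s : clifford R d) (A B : {set 'I_d}).

Definition hcoef v A : VR := (v : {ffun {set 'I_d} -> VR}) A.

Definition hnorm v : R := Num.sqrt (\sum_A `|hcoef v A| ^+ 2).

Let sumsq_ge0 (f : {set 'I_d} -> R) : 0 <= \sum_A f A ^+ 2.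
Proof. by apply: sumr_ge0 => A _; exact: sqr_ge0. Qed.

Let cauchy_schwarz (a b : {set 'I_d} -> R) :
  (\sum_A a A * b A) ^+ 2 <= (\sum_A a A ^+ 2) * (\sum_A b A ^+ 2).
Proof.
set X := \sum_A a A ^+ 2; set Y := \sum_A b A ^+ 2; set P := \sum_A a A * b A.
have [Y0|Yn0] := eqVneq Y 0.
  have b0 A : b A = 0.
    apply/eqP; rewrite -sqrf_eq0; apply/eqP; apply: (psumr_eq0P _ Y0) => //.
    by move=> B _; exact: sqr_ge0.
  by rewrite Y0 mulr0 /P big1 ?expr0n // => A _; rewrite b0 mulr0.
have Ygt0 : 0 < Y by rewrite lt_neqAle eq_sym Yn0 sumsq_ge0.
rewrite -subr_ge0 -(pmulr_rge0 _ Ygt0).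
have -> : Y * (X * Y - P ^+ 2) = \sum_A (Y * a A - P * b A) ^+ 2.
  under eq_bigr => A _ do rewrite sqrrB !exprMn.
  rewrite big_split sumrB /= -!mulr_sumr -/X -/Y.
  have -> : \sum_A Y * a A * (P * b A) *+ 2 = Y * P * P *+ 2.
    rewrite sumrMnl -[X in Y * P * X]/(\sum_A a A * b A) mulr_sumr.
    congr (_ *+ 2).
    by apply: eq_bigr => A _; rewrite mulrACA.
  by ring.
exact: sumsq_ge0.
Qed.

Fact ler_hnormD v w : hnorm (v + w) <= hnorm v + hnorm w.
Proof.
rewrite -(ler_sqr (sqrtr_ge0 _)) ?nnegrE ?addr_ge0 ?sqrtr_ge0 //.
rewrite sqrrD !sqr_sqrtr ?sumsq_ge0 //.
apply: (@le_trans _ _ (\sum_A (`|hcoef v A| + `|hcoef w A|) ^+ 2)).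
  apply: ler_sum => A _; rewrite ler_sqr ?nnegrE ?addr_ge0 //.
  by rewrite /hcoef ffunE ler_normD.
under eq_bigr => A _ do rewrite sqrrD.
rewrite !big_split /= lerD2r lerD2l [leRHS]mulr2n.
suff h : \sum_A `|hcoef v A| * `|hcoef w A| <= hnorm v * hnorm w by rewrite lerD.
rewrite /hnorm -sqrtrM ?sumsq_ge0 //; apply: le_trans (ler_norm _) _.
by rewrite -sqrtr_sqr ler_wsqrtr // cauchy_schwarz.
Qed.

Fact hnormZ (a : R) v : hnorm (a *: v) = `|a| * hnorm v.
Proof.
rewrite /hnorm -[`|a|]sqrtr_sqr -sqrtrM ?sqr_ge0 //.
congr Num.sqrt; rewrite mulr_sumr; apply: eq_bigr => A _.
by rewrite /hcoef ffunE normrZ exprMn real_normK ?num_real.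
Qed.

Fact hnorm0_eq0 v : hnorm v = 0 -> v = 0.
Proof.
move=> /eqP; rewrite sqrtr_eq0 => v0.
have {}v0 : \sum_A `|hcoef v A| ^+ 2 = 0 by apply/eqP; rewrite eq_le v0 sumsq_ge0.
apply/ffunP => A; rewrite ffunE; apply/eqP; rewrite -normr_eq0 -sqrf_eq0; apply/eqP.
by apply: (psumr_eq0P _ v0) => // B _; exact: sqr_ge0.
Qed.

HB.instance Definition _ :=
  Lmodule_isNormed.Build R hmodule ler_hnormD hnormZ hnorm0_eq0.

Lemma hmodule_normE v : `|v| = Num.sqrt (\sum_A `|hcoef v A| ^+ 2).
Proof. by []. Qed.

Definition tensor (x : VR) (a : clifford R d) : hmodule :=
  [ffun A => ccoef a A *: x].

Definition lmulC s v : hmodule :=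
  \sum_A \sum_B tensor (ccoef s B *: hcoef v A) (cbasis B * cbasis A).

Definition rmulC v s : hmodule :=
  \sum_A \sum_B tensor (ccoef s B *: hcoef v A) (cbasis A * cbasis B).

Definition cinner v w : clifford R d :=
  \sum_A \sum_B inner (hcoef v A) (hcoef w B) *: (cconj (cbasis A) * cbasis B).

End HilbertModule.

(* Unbounded operators: the values of [opval T] outside [dom T] are irrelevant,
   and [opeq] is equality of partial functions. *)
Record operator (V : Type) := Operator { dom : set V; opval :> V -> V }.

Section OperatorAlgebra.
Variables (R : realType) (d : nat) (VR : hilbertType R).
Local Notation V := (hmodule d VR).
Implicit Types (T U : operator V) (s : clifford R d).

Definition opeq T U : Prop :=
  dom T = dom U /\ forall v, dom T v -> T v = U v.

Definition opsub T U : operator V :=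
  Operator (dom T `&` dom U) (fun v => T v - U v).

Definition opcomp T U : operator V :=
  Operator [set v | dom U v /\ dom T (U v)] (fun v => T (U v)).

Definition oplmul s : operator V := Operator setT (lmulC s).

Definition opinjective T : Prop :=
  forall v w, dom T v -> dom T w -> T v = T w -> v = w.

(* meaningful only under [opinjective T]; [xget] then picks the unique preimage *)
Definition opinv T : operator V :=
  Operator [set T v | v in dom T]
           (fun w => xget 0 [set v | dom T v /\ T v = w]).

Definition right_linear T : Prop :=
  [/\ dom T 0,
      forall v w, dom T v -> dom T w -> dom T (v + w) /\ T (v + w) = T v + T w &
      forall v s, dom T v -> dom T (rmulC v s) /\ T (rmulC v s) = rmulC (T v) s].

Definition closed_operator T : Prop :=
  closed [set p : V * V | dom T p.1 /\ p.2 = T p.1].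

(* the class K(V) *)
Definition closed_right_linear T : Prop := right_linear T /\ closed_operator T.

(* the class B(V) *)
Definition bounded_right_linear T : Prop :=
  [/\ dom T = setT, right_linear T & exists M : R, forall v, `|T v| <= M * `|v|].

(* For a densely defined T the vector v_w selected by [xget] is unique. *)
Definition adjoint T : operator V :=
  let rep w : set V :=
    [set vw | forall v, dom T v -> cinner vw v = cinner w (T v)] in
  Operator [set w | exists vw, rep w vw] (fun w => xget 0 (rep w)).

Definition Qop s T : operator V :=
  Operator (dom (opcomp T T))
           (fun v => T (T v) - (2 * Sc s) *: T v + cnormsq s *: v).

Definition rho_S T : set (clifford R d) :=
  [set s | paravector s /\
           opinjective (Qop s T) /\ bounded_right_linear (opinv (Qop s T))].

Definition sigma_S T : set (clifford R d) := paravector `\` rho_S T.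

Definition SL_resolvent s T : operator V :=
  opsub (opcomp (opinv (Qop s T)) (oplmul (cconj s)))
        (opcomp T (opinv (Qop s T))).

Definition SR_resolvent s T : operator V :=
  opcomp (opsub (oplmul (cconj s)) T) (opinv (Qop s T)).

End OperatorAlgebra.

(* Main.v *)
Require Import Defs.
From HB Require Import structures.
From mathcomp Require Import all_boot all_order all_algebra.
From mathcomp Require Import all_classical all_reals all_analysis.
From mathcomp Require Import ring lra.
Set Implicit Arguments.
Unset Strict Implicit.
Unset Printing Implicit Defensive.
Import Order.TTheory GRing.Theory Num.Theory.
Import numFieldNormedType.Exports.
Local Open Scope classical_set_scope.
Local Open Scope ring_scope.

(** Everything can be read off from the real Hilbert space underlying [V].  The
    coefficient of the Clifford-valued inner product of [v] and [w] at [e_C] is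
    the real inner product of [v e_C] and [w] ([ccoef_cinner]).  A right-linear
    operator has a domain stable under right multiplication, so its adjoint for
    the Clifford-valued product is its adjoint for the real one ([adjointP]).

    Let [s] be in the S-resolvent set of [T], let [B] be the inverse of
    [Q = Q_s[T]], and let [U] be the adjoint of [T].  Since [Q] is a real
    polynomial in [T], [B T v = T B v] on [dom T] ([inv_Qop_commute]).  Both [B]
    and [A = T B] are everywhere defined.  [B] is bounded by assumption; [A] is
    bounded because each [w] in the dense subspace [dom U] has an adjoint image
    under [A], namely [B* U w] ([hellinger_toeplitz], from the uniform
    boundedness principle).  Testing against vectors of [dom T] then gives
    [U B* = A*] and [U A* = 1 + 2 s_0 A* - |s|^2 B*], that is, [Q_s[U] B* = 1].
    Moreover [Q_s[U]] is injective because it is formally adjoint to the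
    surjective [Q].  So [Q_s[U]] has the bounded inverse [B*]
    ([adjoint_inv_Qop]).  The inverse is verified directly, not through the
    adjoint of the unbounded [Q], whose domain would first have to be shown
    dense.

    The argument uses only that [U] is adjoint to [T] and that [dom U] is dense.
    For [T] closed, [dom U] is dense ([adjoint_dense]) and [T] is in turn the
    adjoint of [U] ([biadjoint]); both come from projecting orthogonally onto the
    graph of [T].  Exchanging [T] and [U] therefore gives the other inclusion of
    resolvent sets.

    The S-resolvents of [T] are built from the everywhere defined operators [B],
    [T B] and left multiplications.  Their adjoints are [B*], [T* B*] and the
    left multiplications by the conjugates ([inner_lmulC]), and the two
    formulas follow term by term. *)

(** * Hilbert spaces: projection, representation and boundedness *)

Lemma nonexpansive_continuous (R : realType) (V W : normedModType R)
    (f : V -> W) :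
  (forall x y, `|f x - f y| <= `|x - y|) -> continuous f.
Proof.
move=> f1 x; apply/cvgrPdist_lt => e e0; apply/nbhs_normP; exists e => //= y.
exact: le_lt_trans.
Qed.

Lemma norm_sqrD_eq0 (R : realType) (V : normedModType R) (x y : V) :
  `|x| ^+ 2 + `|y| ^+ 2 = 0 -> x = 0 /\ y = 0.
Proof.
move=> /eqP; rewrite paddr_eq0 ?sqr_ge0 // !sqrf_eq0 !normr_eq0.
by move=> /andP[/eqP -> /eqP ->].
Qed.

Lemma continuous_pair (X Y Z : topologicalType) (f : X -> Y) (g : X -> Z) :
  continuous f -> continuous g -> continuous (fun x => (f x, g x)).
Proof. by move=> fc gc x; apply: cvg_pair; [exact: fc|exact: gc]. Qed.

Section InnerProduct.
Variables (R : realType) (H : hilbertType R).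
Implicit Types (x y z : H) (W : set H).

Lemma inner0l x : inner 0 x = 0.
Proof. by rewrite -(scale0r (0 : H)) innerZl mul0r. Qed.

Lemma innerNl x y : inner (- x) y = - inner x y.
Proof. by rewrite -scaleN1r innerZl mulN1r. Qed.

Lemma innerBl x y z : inner (x - y) z = inner x z - inner y z.
Proof. by rewrite innerDl innerNl. Qed.

Lemma inner0r x : inner x 0 = 0.
Proof. by rewrite innerC inner0l. Qed.

Lemma innerDr x y z : inner x (y + z) = inner x y + inner x z.
Proof. by rewrite innerC innerDl innerC (innerC z). Qed.

Lemma innerZr a x y : inner x (a *: y) = a * inner x y.
Proof. by rewrite innerC innerZl innerC. Qed.

Lemma innerNr x y : inner x (- y) = - inner x y.
Proof. by rewrite innerC innerNl innerC. Qed.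

Lemma innerBr x y z : inner x (y - z) = inner x y - inner x z.
Proof. by rewrite innerDr innerNr. Qed.

Lemma inner_nondegenerate x : inner x x = 0 -> x = 0.
Proof. by move=> /eqP; rewrite innerxx sqrf_eq0 normr_eq0 => /eqP. Qed.

Lemma inner_inj x y : (forall z, inner x z = inner y z) -> x = y.
Proof.
move=> xy; apply/subr0_eq/inner_nondegenerate.
by rewrite innerBl xy subrr.
Qed.

Lemma inner_cauchy_schwarz x y : `|inner x y| <= `|x| * `|y|.
Proof.
have [->|x0] := eqVneq x 0; first by rewrite inner0l !normr0 mul0r.
have [->|y0] := eqVneq y 0; first by rewrite inner0r !normr0 mulr0.
have xp : 0 < `|x| by rewrite normr_gt0.
have yp : 0 < `|y| by rewrite normr_gt0.
have xyp : 0 < 2 * (`|x| * `|y|) by rewrite !mulr_gt0.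
have sq_ge0 e : 0 <= inner (`|y| *: x + e *: (`|x| *: y))
                         (`|y| *: x + e *: (`|x| *: y)).
  by rewrite innerxx sqr_ge0.
have /= hN := sq_ge0 (-1); have /= hP := sq_ge0 1.
rewrite !(innerDl, innerDr, innerZl, innerZr) (innerC y x) !innerxx in hN hP.
rewrite ler_norml; apply/andP; split; rewrite -(ler_pM2l xyp); nra.
Qed.

Definition linear_subspace W : Prop :=
  W 0 /\ forall a x y, W x -> W y -> W (a *: x + y).

Lemma linear_subspaceD W x y : linear_subspace W -> W x -> W y -> W (x + y).
Proof. by move=> [_ sW] Wx Wy; rewrite -[x]scale1r; apply: sW. Qed.

Lemma linear_subspaceZ W a x : linear_subspace W -> W x -> W (a *: x).
Proof. by move=> [W0 sW] Wx; rewrite -[_ *: _]addr0; apply: sW. Qed.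

Lemma linear_subspaceB W x y : linear_subspace W -> W x -> W y -> W (x - y).
Proof.
by move=> sW Wx Wy; rewrite -scaleN1r; apply: linear_subspaceD => //; apply: linear_subspaceZ.
Qed.

Lemma closure_approx W x e : closure W x -> 0 < e ->
  exists2 w, W w & `|x - w| < e.
Proof.
move=> clx e0; have [w [Ww bw]] := clx _ (nbhsx_ballx x e e0).
by exists w => //; move: bw; rewrite -ball_normE.
Qed.

Lemma dense_approx W x e : dense W -> 0 < e -> exists2 w, W w & `|x - w| < e.
Proof.
move=> dW e0; have [||w [bw Ww]] := dW (ball x e).
- by exists x; exact: ballxx.
- exact: ball_open.
- by exists w => //; move: bw; rewrite -ball_normE.
Qed.

Lemma dense_inner_inj W x y : dense W ->
  (forall w, W w -> inner x w = inner y w) -> x = y.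
Proof.
move=> dW xy; apply/subr0_eq/eqP; rewrite -normr_le0.
apply/ler_addgt0Pr => e e0; rewrite add0r.
have [w Ww xyw] := dense_approx (x - y) dW e0.
have xyE : inner (x - y) (x - y - w) = `|x - y| ^+ 2.
  by rewrite innerBr innerxx innerBl xy // subrr subr0.
have := inner_cauchy_schwarz (x - y) (x - y - w).
rewrite xyE ger0_norm ?sqr_ge0 // expr2.
have [->|nz] := eqVneq `|x - y| 0; first by move=> _; exact: ltW.
rewrite ler_pM2l; last by rewrite lt_neqAle eq_sym nz normr_ge0.
by move=> /le_trans; apply; exact: ltW.
Qed.

(** Projecting onto the closure keeps the minimising sequence inside [W], so the
    statement serves both closed subspaces and density proofs. *)
Lemma orthogonal_projection W x : linear_subspace W ->
  exists2 p, closure W p & forall w, W w -> inner (x - p) w = 0.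
Proof.
move=> sW; have [W0 _] := sW.
pose S := [set `|x - w| ^+ 2 | w in W].
have S0 : S !=set0 by exists (`|x - 0| ^+ 2), 0.
have lS : lbound S 0 by move=> _ [w _ <-]; exact: sqr_ge0.
pose dl := inf S.
have dlP w : W w -> dl <= inner (x - w) (x - w).
  by move=> Ww; rewrite innerxx; apply: ge_inf; [exists 0|exists w].
have near_inf n : {w | W w /\ inner (x - w) (x - w) < dl + n.+1%:R^-1}.
  apply: cid; have [] := @inf_adherent _ S n.+1%:R^-1.
  - by rewrite invr_gt0.
  - by split=> //; exists 0.
  - by move=> _ [w Ww <-] lt; exists w; rewrite innerxx.
pose u n := sval (near_inf n).
have uP n : W (u n) /\ inner (x - u n) (x - u n) < dl + n.+1%:R^-1.
  exact: svalP (near_inf n).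
(* By the parallelogram identity, two near-minimisers are close, because their
   midpoint is at distance at least [sqrt dl] from [x]. *)
have uu e m n : m.+1%:R^-1 < e -> n.+1%:R^-1 < e ->
    `|u m - u n| ^+ 2 < 4 * e.
  move=> me ne; have [Wm um] := uP m; have [Wn un] := uP n.
  have mid : W (2^-1 *: (u m + u n)) by apply: linear_subspaceZ (linear_subspaceD _ _ _).
  have := dlP _ mid; rewrite -innerxx.
  have -> : inner (u m - u n) (u m - u n) =
    2 * inner (x - u m) (x - u m) + 2 * inner (x - u n) (x - u n)
    - 4 * inner (x - 2^-1 *: (u m + u n)) (x - 2^-1 *: (u m + u n)).
    rewrite !(innerBl, innerBr, innerDl, innerDr, innerZl, innerZr).
    by rewrite !(innerC _ x) (innerC (u n) (u m)); field.
  move: um un me ne; set am := m.+1%:R^-1; set an := n.+1%:R^-1.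
  by move: am an => am an; lra.
have ucauchy : cauchy (u @ \oo).
  apply/cauchy_ballP => e e0; rewrite near_map2.
  have e4 : 0 < e ^+ 2 / 4 by rewrite divr_gt0 ?exprn_gt0.
  near=> m n.
  rewrite -ball_normE /ball_ /=.
  rewrite -(@ltr_pXn2r _ 2) ?nnegrE ?(ltW e0) //.
  have -> : e ^+ 2 = 4 * (e ^+ 2 / 4) by field.
  apply: uu.
    by near: m; apply: near_infty_natSinv_lt (PosNum e4).
  by near: n; apply: near_infty_natSinv_lt (PosNum e4).
have /cvg_ex[p up] : cvg (u @ \oo) by apply/cauchy_cvgP.
have approx e : 0 < e -> exists w,
    [/\ W w, `|p - w| < e & inner (x - w) (x - w) < dl + e].
  move=> e0.
  suff [n [n1 n2]] : exists n, `|p - u n| < e /\ n.+1%:R^-1 < e.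
    have [Wn un] := uP n; exists (u n); split=> //.
    by apply: lt_trans un _; rewrite ltrD2l.
  near \oo => n; exists n; split; near: n.
    by move/cvgrPdist_lt: up; apply.
  exact: near_infty_natSinv_lt (PosNum e0).
exists p.
  move=> B /nbhs_ballP[e /= e0 eB]; have [w [Ww pw _]] := approx _ e0.
  by exists w; split=> //; apply: eB; rewrite -ball_normE.
move=> w Ww; set c := inner (x - p) w.
(* Moving a near-minimiser by [t *: w] cannot bring it closer than [dl]. *)
have cle t : 2 * t * c <= t ^+ 2 * inner w w.
  apply/ler_addgt0Pr => e e0.
  pose e' := e / (1 + 2 * `|t| * `|w|).
  have q0 : 0 < 1 + 2 * `|t| * `|w| by rewrite ltr_pwDl // !mulr_ge0.
  have e'0 : 0 < e' by rewrite divr_gt0.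
  have [v [Wv pv xv]] := approx _ e'0.
  have Wvt : W (t *: w + v) by case: sW => _; apply.
  have := dlP _ Wvt.
  have -> : inner (x - (t *: w + v)) (x - (t *: w + v)) =
     inner (x - v) (x - v) - 2 * t * c + t ^+ 2 * inner w w
       - 2 * t * inner (p - v) w.
    rewrite /c !(innerBl, innerBr, innerDl, innerDr, innerZl, innerZr).
    by rewrite !(innerC _ x) (innerC v w) ; ring.
  have pvw : - (2 * t * inner (p - v) w) <= 2 * `|t| * `|w| * e'.
    apply: le_trans (ler_norm _) _; rewrite normrN !normrM ger0_norm //.
    rewrite -!mulrA ler_pM2l // ler_wpM2l //.
    apply: le_trans (inner_cauchy_schwarz _ _) _.
    by rewrite mulrC ler_wpM2l // ltW.
  have -> : e = e' + 2 * `|t| * `|w| * e' by rewrite /e'; field; exact: lt0r_neq0.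
  by lra.
have m0 : 0 <= inner w w by rewrite innerxx sqr_ge0.
move: (inner w w) m0 cle => m m0 cle.
have q0 : 0 < 1 + m by lra.
(* At this [t] the inequality reads [(2 + m) c ^+ 2 / (1 + m) ^+ 2 <= 0]. *)
have := cle (c / (1 + m)).
rewrite expr_div_n -subr_ge0.
have -> : c ^+ 2 / (1 + m) ^+ 2 * m - 2 * (c / (1 + m)) * c =
  - ((2 + m) / (1 + m) ^+ 2 * c ^+ 2) by field; exact: lt0r_neq0.
rewrite oppr_ge0 pmulr_rle0; last by rewrite divr_gt0 ?exprn_gt0 //; lra.
by move=> c0; apply/eqP; rewrite -sqrf_eq0 eq_le c0 sqr_ge0.
Unshelve. all: end_near. Qed.

Lemma dense_orthogonal W : linear_subspace W ->
  (forall x, (forall w, W w -> inner x w = 0) -> x = 0) -> dense W.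
Proof.
move=> sW Wperp O [x Ox] oO.
have [p clp xp] := orthogonal_projection x sW.
have /subr0_eq xE := Wperp _ xp; rewrite -xE in clp.
by have [w [Ww Ow]] := clp _ (open_nbhs_nbhs (conj oO Ox)); exists w.
Qed.

(** A nonzero [f] is a multiple of the inner product with a vector [u] orthogonal
    to its kernel: every [v] differs from a multiple of [u] by a vector of the
    kernel. *)
Lemma riesz_representation (f : H -> R) M :
  (forall a x y, f (a *: x + y) = a * f x + f y) ->
  (forall x, `|f x| <= M * `|x|) -> exists z, forall x, f x = inner z x.
Proof.
move=> fl fM.
have f0 : f 0 = 0.
  by apply/eqP; rewrite -normr_le0; apply: le_trans (fM 0) _; rewrite normr0 mulr0.
have fB x y : f (x - y) = f x - f y by rewrite addrC -scaleN1r fl mulN1r addrC.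
have [fz|] := pselect (forall x, f x = 0).
  by exists 0 => x; rewrite inner0l fz.
move=> /existsNP[x fx].
pose K : set H := [set y | f y = 0].
have sK : linear_subspace K by split=> // a y z Ky Kz; rewrite /K /= fl Ky Kz mulr0 addr0.
have [p clp xp] := orthogonal_projection x sK.
have fp : f p = 0.
  apply/eqP; rewrite -normr_le0; apply/ler_addgt0Pr => e e0; rewrite add0r.
  have [w Kw pw] := @closure_approx _ _ (e / (1 + `|M|)) clp
    (divr_gt0 e0 (ltr_pwDl ltr01 (normr_ge0 _))).
  rewrite -[f p]subr0 -[X in _ - X]Kw -fB; apply: le_trans (fM _) _.
  apply: (@le_trans _ _ ((1 + `|M|) * `|p - w|)).
    by rewrite ler_wpM2r // (le_trans (ler_norm _)) // lerDr.
  by rewrite mulrC -ler_pdivlMr ?ltW // ltr_pwDl.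
have fu : f (x - p) = f x by rewrite fB fp subr0.
move: (x - p) xp fu => u Ku fu.
have u0 : inner u u != 0.
  by apply/eqP => /inner_nondegenerate uz; apply: fx; rewrite -fu uz.
exists ((f u / inner u u) *: u) => v; rewrite innerZl.
have Kv : K ((- (f v / f u)) *: u + v).
  by rewrite /K /= fl; field; rewrite fu; exact/eqP.
have := Ku _ Kv; rewrite innerDr innerZr => /eqP; rewrite addrC mulNr subr_eq0.
move=> /eqP ->; field; rewrite u0 fu andbT; exact/eqP.
Qed.

Lemma bounded_adjoint_exists (A : H -> H) M : linear A ->
  (forall x, `|A x| <= M * `|x|) ->
  exists A' : H -> H, forall w v, inner (A' w) v = inner w (A v).
Proof.
move=> lA AM; suff /choice[A' A'P] : forall w, exists z, forall v,
    inner w (A v) = inner z v by exists A' => w v; rewrite A'P.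
move=> w; apply: (@riesz_representation _ (`|w| * M)) => [a x y|x].
  by rewrite lA innerDr innerZr.
apply: le_trans (inner_cauchy_schwarz _ _) _.
by rewrite -mulrA ler_wpM2l.
Qed.

(** The functionals [v |-> inner w (A v)], for [w] in [D] of norm at most [1], are
    bounded since [w] has an adjoint image, and are bounded by [`|A v|] at each
    [v].  The uniform boundedness principle bounds them uniformly on the unit
    ball, and by density they detect the norm of [A v]. *)
Lemma hellinger_toeplitz (A : H -> H) D : linear A -> dense D ->
  (forall w, D w -> exists z, forall v, inner z v = inner w (A v)) ->
  exists M, forall v, `|A v| <= M * `|v|.
Proof.
move=> lA dD adjA.
pose F := [set (fun v => inner w (A v) : R^o) | w in D `&` [set w | `|w| <= 1]].
have [||M FM] := @Banach_Steinhauss R H R^o F _ _ 1.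
- move=> _ [w [Dw _] <-]; split=> [r|a x y]; last first.
    by rewrite lA innerDr innerZr.
  have [z zP] := adjA _ Dw; exists (`|z| * r) => v vr.
  rewrite -zP; apply: le_trans (inner_cauchy_schwarz _ _) _.
  by rewrite ler_wpM2l.
- move=> v; exists `|A v| => _ [w [_ w1] <-].
  apply: le_trans (inner_cauchy_schwarz _ _) _.
  by rewrite ler_piMl.
have AZ a v : A (a *: v) = a *: A v.
  have A0 : A 0 = 0.
    have := lA 1 0 0; rewrite !scale1r addr0 => A00.
    by apply: (@addrI _ (A 0)); rewrite addr0 -A00.
  by rewrite -[a *: v]addr0 lA A0 addr0.
have A1 v : `|v| <= 1 -> `|A v| <= 4 * M.
  move=> v1; set y := A v.
  have [->|y0] := eqVneq y 0.
    rewrite normr0; have [w Dw w1] := @dense_approx _ 0 1 dD ltr01.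
    rewrite mulr_ge0 //; apply: le_trans (normr_ge0 _) _; last first.
      apply: (FM (fun v => inner w (A v)) _ v v1); exists w => //; split=> //=.
      by move: w1; rewrite sub0r normrN => /ltW.
  (* [w] is taken within [1/4] of the vector of norm [1/2] in the direction of
     [y]: then [`|w| <= 1] and [inner w y >= `|y| / 4]. *)
  have yp : 0 < `|y| by rewrite normr_gt0.
  have q : 0 < (4 : R)^-1 by rewrite invr_gt0.
  have [w Dw wy] := @dense_approx _ ((2 * `|y|)^-1 *: y) _ dD q.
  have nz : `|(2 * `|y|)^-1 *: y| = 2^-1.
    rewrite normrZ ger0_norm ?invr_ge0 ?mulr_ge0 //; field.
    exact: lt0r_neq0.
  have w1 : `|w| <= 1.
    have := ler_normB ((2 * `|y|)^-1 *: y) ((2 * `|y|)^-1 *: y - w).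
    by rewrite subKr nz; lra.
  have wM : `|inner w y| <= M by apply: (FM (fun v => inner w (A v)) _ v v1); exists w.
  have e1 : inner ((2 * `|y|)^-1 *: y) y = `|y| / 2.
    by rewrite innerZl innerxx; field; exact: lt0r_neq0.
  have := inner_cauchy_schwarz ((2 * `|y|)^-1 *: y - w) y.
  rewrite innerBl e1.
  have : `|(2 * `|y|)^-1 *: y - w| * `|y| <= 4^-1 * `|y|.
    by rewrite ler_wpM2r // ltW.
  move=> h1 h2; have := le_trans (ler_norm _) (le_trans h2 h1).
  have := le_trans (ler_norm _) wM; lra.
exists (4 * M) => v; have [->|v0] := eqVneq v 0.
  by rewrite -(scale0r (0 : H)) AZ !scale0r normr0 mulr0.
have vp : 0 < `|v| by rewrite normr_gt0.
rewrite -ler_pdivrMr // mulrC -[X in X * _]ger0_norm ?invr_ge0 // -normrZ -AZ.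
by apply: A1; rewrite normrZ ger0_norm ?invr_ge0 // mulVf ?normr_eq0.
Qed.

End InnerProduct.

(** * Signs in the Clifford algebra *)

Section CliffordSigns.
Variables (R : comNzRingType) (d : nat).
Implicit Types (A B C : {set 'I_d}).

Lemma symdiffA A B C : symdiff A (symdiff B C) = symdiff (symdiff A B) C.
Proof.
by apply/setP => i; rewrite !inE; case: (i \in A); case: (i \in B);
  case: (i \in C).
Qed.

Lemma symdiffC A B : symdiff A B = symdiff B A.
Proof. by rewrite /symdiff finset.setUC. Qed.

Lemma symdiffK B : involutive (fun A => symdiff A B).
Proof.
by move=> A; apply/setP => i; rewrite !inE; case: (i \in A); case: (i \in B).
Qed.

Lemma symdiff0 A : symdiff A finset.set0 = A.
Proof. by apply/setP => i; rewrite !inE; case: (i \in A). Qed.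

Lemma csign_sq A B : csign R A B * csign R A B = 1.
Proof. by rewrite /csign -exprD addnn -signr_odd odd_double. Qed.

(** The common part of [A] and [B] is counted twice on the right, which does not
    change the parity; this makes [csign] multiplicative in each argument. *)
Lemma sign_sum_symdiff (g : 'I_d -> nat) A B :
  (-1) ^+ (\sum_(i in symdiff A B) g i)%N =
  (-1) ^+ (\sum_(i in A) g i)%N * (-1) ^+ (\sum_(i in B) g i)%N :> R.
Proof.
rewrite -exprD -signr_odd -[RHS]signr_odd; congr ((-1) ^+ (nat_of_bool _)).
rewrite oddD !(big_morph odd oddD (erefl : odd 0 = false)).
rewrite big_mkcond [X in _ = X (+) _]big_mkcond [X in _ = _ (+) X]big_mkcond.
rewrite -big_split; apply: eq_bigr => i _ /=; rewrite !inE.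
by case: (i \in A); case: (i \in B); case: (odd (g i)).
Qed.

Lemma csignDl A B C : csign R (symdiff A B) C = csign R A C * csign R B C.
Proof. exact: sign_sum_symdiff. Qed.

Lemma csignDr A B C : csign R A (symdiff B C) = csign R A B * csign R A C.
Proof.
rewrite /csign exchange_big sign_sum_symdiff /=.
by congr (_ ^+ _ * _ ^+ _); rewrite exchange_big.
Qed.

(** Counting the pairs [j <= i] in [A x A] twice, once in each order, counts every
    pair once and the diagonal once more.  Hence conjugation multiplies [e_A] by
    the sign of the product [e_A e_A]. *)
Lemma csign_diag A : csign R A A = (-1) ^+ (#|A| * #|A|.+1)./2.
Proof.
rewrite /csign; set n := (\sum_(i in A) _)%N; congr (_ ^+ _).
suff -> : (#|A| * #|A|.+1 = n.*2)%N by rewrite doubleK.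
have nE : n = (\sum_(i in A) \sum_(j in A) (i <= j : nat))%N.
  by rewrite /n exchange_big.
rewrite -addnn {2}nE /n -big_split /=.
under eq_bigr => i iA.
  rewrite -big_split /=.
  under eq_bigr => j jA.
    have -> : ((j <= i) + (i <= j) = 1 + (j == i))%N.
      by rewrite -val_eqE /=; case: (ltngtP j i).
    over.
  rewrite big_split /= sum1_card.
  rewrite (bigD1 i) //= eqxx big1 => [|j /andP[_ /negPf->]] //.
  over.
by rewrite sum_nat_const addn0 addn1.
Qed.

Lemma cconj_basis A : cconj (cbasis A) = csign R A A *: cbasis A :> clifford R d.
Proof.
apply: cliffordP => B; rewrite /cconj ccoef_sum (bigD1 A) //= !ccoefZ csign_diag.
rewrite (ccoef_basis R A A) eqxx mulr1 big1 ?addr0 // => C CA.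
by rewrite ccoefZ [ccoef (cbasis A) C]ccoef_basis (negPf CA) mulr0 mul0r.
Qed.

Lemma ccoef_conj (s : clifford R d) A : ccoef (cconj s) A = csign R A A * ccoef s A.
Proof.
rewrite /cconj ccoef_sum (bigD1 A) //= ccoefZ ccoef_basis eqxx mulr1 csign_diag.
rewrite big1 ?addr0 // => B BA.
by rewrite ccoefZ ccoef_basis eq_sym (negPf BA) mulr0.
Qed.

Lemma cconjK : involutive (@cconj R d).
Proof.
by move=> s; apply: cliffordP => A; rewrite !ccoef_conj mulrA csign_sq mul1r.
Qed.

Lemma Sc_conj (s : clifford R d) : Sc (cconj s) = Sc s.
Proof. by rewrite /Sc ccoef_conj /csign big_set0 expr0 mul1r. Qed.

Lemma cnormsq_conj (s : clifford R d) : cnormsq (cconj s) = cnormsq s.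
Proof.
rewrite /cnormsq; apply: eq_bigr => A _.
by rewrite ccoef_conj exprMn [_ ^+ 2]csign_sq mul1r.
Qed.

End CliffordSigns.

(** * The real Hilbert space underlying a Hilbert module *)

Section HilbertModuleStructure.
Variables (R : realType) (d : nat) (VR : hilbertType R).
Local Notation V := (hmodule d VR).
Implicit Types (v w : V) (s t : clifford R d) (A B C : {set 'I_d}).

Lemma hmoduleP v w : (forall A, hcoef v A = hcoef w A) -> v = w.
Proof. by move=> vw; apply/ffunP. Qed.

Lemma hcoefD v w A : hcoef (v + w) A = hcoef v A + hcoef w A.
Proof. by rewrite /hcoef ffunE. Qed.

Lemma hcoefB v w A : hcoef (v - w) A = hcoef v A - hcoef w A.
Proof. by rewrite /hcoef !ffunE. Qed.

Lemma hcoefZ a v A : hcoef (a *: v) A = a *: hcoef v A.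
Proof. by rewrite /hcoef ffunE. Qed.

Lemma hcoef0 A : hcoef (0 : V) A = 0.
Proof. by rewrite /hcoef ffunE. Qed.

Lemma hcoef_sum (I : finType) (F : I -> V) A :
  hcoef (\sum_i F i) A = \sum_i hcoef (F i) A.
Proof.
exact: (big_morph (fun v => hcoef v A) (fun v w => hcoefD v w A) (hcoef0 A)).
Qed.

Definition hinner v w : R := \sum_A inner (hcoef v A) (hcoef w A).

Fact hinnerC v w : hinner v w = hinner w v.
Proof. by apply: eq_bigr => A _; exact: innerC. Qed.

Fact hinnerDl u v w : hinner (u + v) w = hinner u w + hinner v w.
Proof.
by rewrite /hinner -big_split; apply: eq_bigr => A _; rewrite hcoefD innerDl.
Qed.

Fact hinnerZl a v w : hinner (a *: v) w = a * hinner v w.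
Proof.
by rewrite /hinner mulr_sumr; apply: eq_bigr => A _; rewrite hcoefZ innerZl.
Qed.

Fact hinnerxx v : hinner v v = `|v| ^+ 2.
Proof.
rewrite hmodule_normE sqr_sqrtr; first by apply: eq_bigr => A _; rewrite innerxx.
by apply: sumr_ge0 => A _; exact: sqr_ge0.
Qed.

Lemma hcoef_norm_le v A : `|hcoef v A| <= `|v|.
Proof.
rewrite -ler_sqr ?nnegrE // -hinnerxx /hinner (bigD1 A) //= innerxx lerDl.
by apply: sumr_ge0 => B _; rewrite innerxx sqr_ge0.
Qed.

Lemma hnorm_le_sum v : `|v| <= \sum_A `|hcoef v A|.
Proof.
rewrite -ler_sqr ?nnegrE ?sumr_ge0 // -hinnerxx expr2 mulr_suml.
apply: ler_sum => A _; rewrite innerxx expr2 ler_wpM2l //.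
by rewrite (bigD1 A) //= lerDl sumr_ge0.
Qed.

Fact hmodule_complete (F : set_system V) : ProperFilter F -> cauchy F -> cvg F.
Proof.
move=> FF /cauchy_ballP Fc.
have cvgA A : cvg ((fun v => hcoef v A) @ F).
  apply/cauchy_cvgP/cauchy_ballP => e e0; rewrite near_map2.
  apply: filterS (Fc _ e0) => -[v w] /=; rewrite -!ball_normE /ball_ /= -hcoefB.
  exact: le_lt_trans (hcoef_norm_le _ _).
pose l : V := [ffun A => lim ((fun v => hcoef v A) @ F)].
apply/cvg_ex; exists l; apply/cvgrPdist_lt => e e0.
pose N := #|{set 'I_d}|.+1.
have eN : 0 < e / N%:R by rewrite divr_gt0.
have nearA : \forall v \near F, forall A, `|hcoef l A - hcoef v A| < e / N%:R.
  apply: filter_forall => A.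
  have -> : hcoef l A = lim ((fun v => hcoef v A) @ F) by rewrite /hcoef ffunE.
  by have /cvgrPdist_lt := cvgA A; apply.
near=> v; apply: le_lt_trans (hnorm_le_sum _) _.
apply: (@le_lt_trans _ _ (\sum_(A : {set 'I_d}) e / N%:R)).
  apply: ler_sum => A _; rewrite hcoefB; apply: ltW.
  by move: A; near: v.
rewrite sumr_const -[_ *+ #|_|]mulr_natr -mulrA gtr_pMr //.
by rewrite mulrC ltr_pdivrMr // mul1r ltr_nat.
Unshelve. all: end_near. Qed.

HB.instance Definition _ := Uniform_isComplete.Build V hmodule_complete.
HB.instance Definition _ := NormedModule_hasInner.Build R V
  hinnerC hinnerDl hinnerZl hinnerxx.

Lemma hmodule_innerE v w : inner v w = \sum_A inner (hcoef v A) (hcoef w A).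
Proof. by []. Qed.

Lemma hcoef_continuous A : continuous (fun v => hcoef v A).
Proof.
apply: nonexpansive_continuous => v w; rewrite -hcoefB; exact: hcoef_norm_le.
Qed.

Lemma hcoef_rmulC v s C : hcoef (rmulC v s) C =
  \sum_B (ccoef s B * csign R (symdiff C B) B) *: hcoef v (symdiff C B).
Proof.
rewrite /rmulC exchange_big hcoef_sum; apply: eq_bigr => B _ /=.
rewrite hcoef_sum (bigD1 (symdiff C B)) //= big1 ?addr0 => [|A AC].
  rewrite /tensor {1}/hcoef ffunE cbasisM ccoefZ ccoef_basis symdiffK eqxx mulr1.
  by rewrite scalerA mulrC.
rewrite /tensor {1}/hcoef ffunE cbasisM ccoefZ ccoef_basis.
case: eqP => [CE|_]; last by rewrite mulr0 scale0r.
by move: AC; rewrite CE symdiffK eqxx.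
Qed.

Lemma hcoef_lmulC v s C : hcoef (lmulC s v) C =
  \sum_B (ccoef s B * csign R B (symdiff C B)) *: hcoef v (symdiff C B).
Proof.
rewrite /lmulC exchange_big hcoef_sum; apply: eq_bigr => B _ /=.
rewrite hcoef_sum (bigD1 (symdiff C B)) //= big1 ?addr0 => [|A AC].
  rewrite /tensor {1}/hcoef ffunE cbasisM ccoefZ ccoef_basis (symdiffC B) symdiffK.
  by rewrite eqxx mulr1 scalerA mulrC.
rewrite /tensor {1}/hcoef ffunE cbasisM ccoefZ ccoef_basis.
case: eqP => [CE|_]; last by rewrite mulr0 scale0r.
by move: AC; rewrite CE (symdiffC B) symdiffK eqxx.
Qed.

Lemma rmulCD v w s : rmulC (v + w) s = rmulC v s + rmulC w s.
Proof.
apply: hmoduleP => C; rewrite hcoefD !hcoef_rmulC -big_split.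
by apply: eq_bigr => B _; rewrite hcoefD scalerDr.
Qed.

Lemma rmulCZ a v s : rmulC (a *: v) s = a *: rmulC v s.
Proof.
apply: hmoduleP => C; rewrite hcoefZ !hcoef_rmulC scaler_sumr.
by apply: eq_bigr => B _; rewrite hcoefZ !scalerA mulrC.
Qed.

Lemma rmulCB v w s : rmulC (v - w) s = rmulC v s - rmulC w s.
Proof. by rewrite -scaleN1r rmulCD rmulCZ scaleN1r. Qed.

Lemma rmulC_scalar v a : rmulC v a%:A = a *: v.
Proof.
apply: hmoduleP => C; rewrite hcoefZ hcoef_rmulC (bigD1 finset.set0) //=.
have cA B : ccoef (a%:A : clifford R d) B = a * (B == finset.set0)%:R.
  by rewrite ccoefZ [ccoef 1 B]ccoef_basis.
rewrite symdiff0 cA eqxx mulr1 /csign big1 => [|i _]; last by rewrite big_set0.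
rewrite expr0 mulr1 big1 ?addr0 // => B B0.
by rewrite cA (negPf B0) mulr0 mul0r scale0r.
Qed.

Lemma lmulCD s v w : lmulC s (v + w) = lmulC s v + lmulC s w.
Proof.
apply: hmoduleP => C; rewrite hcoefD !hcoef_lmulC -big_split.
by apply: eq_bigr => B _; rewrite hcoefD scalerDr.
Qed.

Lemma lmulC_rmulC s v t : lmulC s (rmulC v t) = rmulC (lmulC s v) t.
Proof.
apply: hmoduleP => C; rewrite hcoef_lmulC hcoef_rmulC.
under eq_bigr => B _ do rewrite hcoef_rmulC scaler_sumr.
under [RHS]eq_bigr => B _ do rewrite hcoef_lmulC scaler_sumr.
rewrite exchange_big; apply: eq_bigr => B _; apply: eq_bigr => D _.
rewrite !scalerA -!symdiffA (symdiffC D B) !(csignDl, csignDr); congr (_ *: _).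
by ring.
Qed.

(** Each [e_B] permutes the coordinates by [C |-> symdiff C B] up to the sign
    [csign], and passing to the inverse permutation produces the extra sign
    [csign B B] of the conjugation. *)
Lemma inner_rmulC v w s : inner (rmulC v s) w = inner v (rmulC w (cconj s)).
Proof.
rewrite !hmodule_innerE.
under eq_bigr => C _ do
  (rewrite hcoef_rmulC innerC (big_morph _ (innerDr _) (inner0r _))).
under [RHS]eq_bigr => C _ do
  (rewrite hcoef_rmulC (big_morph _ (innerDr _) (inner0r _))).
rewrite exchange_big [RHS]exchange_big; apply: eq_bigr => B _ /=.
rewrite (reindex_inj (can_inj (symdiffK B))); apply: eq_bigr => C _ /=.
rewrite symdiffK !innerZr ccoef_conj csignDl innerC; congr (_ * _).
by rewrite -[LHS]mulr1 -(csign_sq R B B); ring.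
Qed.

Lemma inner_lmulC v w s : inner (lmulC s v) w = inner v (lmulC (cconj s) w).
Proof.
rewrite !hmodule_innerE.
under eq_bigr => C _ do
  (rewrite hcoef_lmulC innerC (big_morph _ (innerDr _) (inner0r _))).
under [RHS]eq_bigr => C _ do
  (rewrite hcoef_lmulC (big_morph _ (innerDr _) (inner0r _))).
rewrite exchange_big [RHS]exchange_big; apply: eq_bigr => B _ /=.
rewrite (reindex_inj (can_inj (symdiffK B))); apply: eq_bigr => C _ /=.
rewrite symdiffK !innerZr ccoef_conj csignDr innerC; congr (_ * _).
by rewrite -[LHS]mulr1 -(csign_sq R B B); ring.
Qed.

(** The bridge between the two inner products: the real one, evaluated on right
    multiples, recovers every coefficient of the Clifford-valued one. *)
Lemma ccoef_cinner v w C :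
  ccoef (cinner v w) C = inner (rmulC v (cbasis C)) w.
Proof.
rewrite hmodule_innerE /cinner ccoef_sum.
rewrite [RHS](reindex_inj (can_inj (symdiffK C))); apply: eq_bigr => A _ /=.
rewrite ccoef_sum hcoef_rmulC (bigD1 (symdiff A C)) //= [in RHS](bigD1 C) //=.
rewrite !big1 => [|B BC|B BC].
- rewrite !addr0 ccoefZ cconj_basis -scalerAl cbasisM !ccoefZ ccoef_basis.
  rewrite symdiffK (symdiffC A C) symdiffA (symdiffC A C) symdiffK eqxx ccoef_basis.
  rewrite eqxx mul1r mulr1 innerZl csignDr mulrC; congr (_ * _).
  by rewrite mulrC -mulrA csign_sq mulr1.
- by rewrite ccoef_basis (negPf BC) mul0r scale0r.
- rewrite ccoefZ cconj_basis -scalerAl cbasisM !ccoefZ ccoef_basis.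
  case: eqP => [CE|_]; last by rewrite !mulr0.
  by move: BC; rewrite CE (symdiffC A (symdiff A B)) (symdiffC A B) symdiffK eqxx.
Qed.

(** Right-linearity of [f] turns the [e_C] coefficient of the equation at [v] into
    its scalar part at [v] times the conjugate of [e_C]. *)
Lemma cinner_right_linear_ext (D : set V) (f : V -> V) (w z : V) :
  (forall v s, D v -> D (rmulC v s) /\ f (rmulC v s) = rmulC (f v) s) ->
  (forall v, D v -> cinner z v = cinner w (f v)) <->
  (forall v, D v -> inner z v = inner w (f v)).
Proof.
move=> Df; split=> zw v Dv.
  have rm0 (u : V) : rmulC u (cbasis finset.set0) = u.
    by have := rmulC_scalar u 1; rewrite !scale1r.
  by rewrite -(rm0 z) -(rm0 w) -!ccoef_cinner zw.
apply: cliffordP => C; rewrite !ccoef_cinner !inner_rmulC.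
by have [Dvs fvs] := Df v (cconj (cbasis C)) Dv; rewrite zw // fvs.
Qed.

End HilbertModuleStructure.

(** * Projection onto a closed graph *)

Section ClosedGraph.
Variables (R : realType) (H : hilbertType R).

(** The module over the Clifford algebra with one generator has two coordinates,
    at the empty set and at the full set: it serves as the orthogonal sum of two
    copies of [H], in which graphs of operators live. *)
Definition hpair (u v : H) : hmodule 1 H :=
  [ffun A => if A == finset.set0 then u else v].

Lemma sum_sets_ord1 (V : nmodType) (F : {set 'I_1} -> V) :
  \sum_A F A = F finset.set0 + F [set: 'I_1]%SET.
Proof.
have T0 : [set: 'I_1]%SET != finset.set0.
  by apply/eqP => /setP/(_ ord0); rewrite !inE.
rewrite (bigD1 finset.set0) //= (bigD1 [set: 'I_1]%SET) //= big1 ?addr0 //.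
move=> A /andP[/set0Pn[i iA] /eqP]; case; apply/setP => j.
by rewrite inE (ord1 j) -(ord1 i).
Qed.

Lemma hpair_fst u v : hcoef (hpair u v) finset.set0 = u.
Proof. by rewrite /hcoef ffunE eqxx. Qed.

Lemma hpair_snd u v : hcoef (hpair u v) [set: 'I_1]%SET = v.
Proof.
by rewrite /hcoef ffunE; case: eqP => // /setP/(_ ord0); rewrite !inE.
Qed.

(** The orthogonal projection of [(w, z)] onto the graph of [T], written
    without the orthogonal sum. *)
Lemma closed_graph_decomposition (D : set H) (T : H -> H) (w z : H) :
  D 0 -> (forall a u v, D u -> D v ->
            D (a *: u + v) /\ T (a *: u + v) = a *: T u + T v) ->
  closed [set p : H * H | D p.1 /\ p.2 = T p.1] ->
  exists2 u, D u &
    forall v, D v -> inner (w - u) v + inner (z - T u) (T v) = 0.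
Proof.
move=> D0 DT clT.
pose fs (p : hmodule 1 H) := (hcoef p finset.set0, hcoef p [set: 'I_1]%SET).
pose G := [set p : hmodule 1 H | D (fs p).1 /\ (fs p).2 = T (fs p).1].
have T0 : T 0 = 0.
  have [_] := DT (-1) 0 0 D0 D0.
  by rewrite scaler0 addr0 scaleN1r addNr.
have sG : linear_subspace G.
  split=> [|a p q [Dp Tp] [Dq Tq]]; rewrite /G /fs /= ?hcoef0 ?T0 //.
  rewrite !hcoefD !hcoefZ; have [Dpq Tpq] := DT a _ _ Dp Dq.
  by move: Tp Tq => /= -> ->.
have fs_cont : continuous fs.
  exact: (continuous_pair (@hcoef_continuous _ _ _ _) (@hcoef_continuous _ _ _ _)).
have clG : closure G `<=` G.
  move=> p clp; apply: (clT (fs p)) => N nN.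
  by have [q [Gq Nq]] := clp _ (fs_cont p N nN); exists (fs q).
have [p /clG[Dp Tp] perp] := orthogonal_projection (hpair w z) sG.
exists (fs p).1 => // v Dv.
have Gv : G (hpair v (T v)) by rewrite /G /fs /= hpair_fst hpair_snd.
have := perp _ Gv; rewrite hmodule_innerE sum_sets_ord1 !hcoefB.
by rewrite !hpair_fst !hpair_snd -Tp.
Qed.

End ClosedGraph.

(** * Right-linear operators and their adjoints *)

Section RightLinearOperators.
Variables (R : realType) (d : nat) (VR : hilbertType R).
Local Notation V := (hmodule d VR).
Implicit Types (T U X : operator V) (s : clifford R d).

Lemma right_linearP T a u v : right_linear T -> dom T u -> dom T v ->
  dom T (a *: u + v) /\ T (a *: u + v) = a *: T u + T v.
Proof.
move=> [_ TD Ts] Du Dv; have [Dau Tau] := Ts u a%:A Du.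
by rewrite !rmulC_scalar in Dau Tau; have [? ->] := TD _ _ Dau Dv; rewrite Tau.
Qed.

Lemma right_linearZ T a u : right_linear T -> dom T u ->
  dom T (a *: u) /\ T (a *: u) = a *: T u.
Proof.
by move=> [_ _ Ts] Du; have := Ts u a%:A Du; rewrite !rmulC_scalar.
Qed.

Lemma right_linearB T u v : right_linear T -> dom T u -> dom T v ->
  dom T (u - v) /\ T (u - v) = T u - T v.
Proof.
move=> lT Du Dv; have := right_linearP (-1) lT Dv Du.
by rewrite !scaleN1r ![- _ + _]addrC.
Qed.

Lemma right_linear_dom T : right_linear T -> linear_subspace (dom T).
Proof.
move=> lT; split; first by case: lT.
by move=> a u v Du Dv; have [] := right_linearP a lT Du Dv.
Qed.

Lemma right_linear_sub T U :
  right_linear T -> right_linear U -> right_linear (opsub T U).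
Proof.
move=> [T0 TD Ts] [U0 UD Us]; split=> // [v w [Tv Uv] [Tw Uw]|v s [Tv Uv]] /=.
  have [Tvw ->] := TD _ _ Tv Tw; have [Uvw ->] := UD _ _ Uv Uw.
  by split=> //; rewrite opprD addrACA.
have [Tvs ->] := Ts v s Tv; have [Uvs ->] := Us v s Uv.
by rewrite rmulCB.
Qed.

Lemma right_linear0 T : right_linear T -> T 0 = 0.
Proof.
move=> lT; have D0 : dom T 0 by case: lT.
by have [_] := right_linearZ 0 lT D0; rewrite !scale0r.
Qed.

Lemma right_linear_comp T U :
  right_linear T -> right_linear U -> right_linear (opcomp T U).
Proof.
move=> lT lU; have [T0 TD Ts] := lT; have [U0 UD Us] := lU.
split=> [|v w [Uv Tv] [Uw Tw]|v s [Uv Tv]] /=.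
- by rewrite right_linear0.
- have [Uvw ->] := UD _ _ Uv Uw; have [Tvw ->] := TD _ _ Tv Tw.
  by [].
- have [Uvs ->] := Us v s Uv; have [Tvs ->] := Ts _ s Tv.
  by [].
Qed.

Lemma right_linear_lmul s : right_linear (oplmul VR s).
Proof.
by split=> // [v w _ _|v t _] /=; rewrite ?lmulCD ?lmulC_rmulC.
Qed.

Lemma right_linear_Qop s T : right_linear T -> right_linear (Qop s T).
Proof.
move=> lT; have lTT := right_linear_comp lT lT.
have [TT0 TTD TTs] := lTT; have [T0 TD Ts] := lT.
split=> // [v w Dv Dw|v t Dv] /=.
  have [Dvw /= TTvw] := TTD _ _ Dv Dw; split=> //.
  rewrite TTvw; have [_ ->] := TD _ _ Dv.1 Dw.1.
  by rewrite !scalerDr opprD [X in X + _ = _]addrACA [LHS]addrACA.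
have [Dvt /= TTvt] := TTs _ t Dv; split=> //.
by rewrite TTvt; have [_ ->] := Ts _ t Dv.1; rewrite rmulCD rmulCB !rmulCZ.
Qed.

Lemma opinvK X w : dom (opinv X) w -> dom X (opinv X w) /\ X (opinv X w) = w.
Proof.
by move=> [v Xv vw]; apply: (@xgetPex _ 0 [set u | dom X u /\ X u = w]); exists v.
Qed.

Lemma opinvE X v : opinjective X -> dom X v -> opinv X (X v) = v.
Proof.
move=> iX Xv; have dXv : dom (opinv X) (X v) by exists v.
by have [? ?] := opinvK dXv; apply: iX.
Qed.

Lemma right_linear_inv X :
  opinjective X -> right_linear X -> right_linear (opinv X).
Proof.
move=> iX lX; have [X0 XD Xs] := lX; split.
- by exists 0 => //; exact: right_linear0.
- move=> _ _ [v Xv <-] [w Xw <-]; have [Xvw vw] := XD _ _ Xv Xw.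
  by rewrite -vw !opinvE //; split=> //; exists (v + w).
- move=> _ t [v Xv <-]; have [Xvt vt] := Xs _ t Xv.
  by rewrite -vt !opinvE //; split=> //; exists (rmulC v t).
Qed.

(** A relation, symmetric for closed densely defined operators, so that a
    lemma about [(T, U)] applies to [(U, T)]; uniqueness of [z] is part of it,
    which for right-linear [T] amounts to density of its domain. *)
Definition is_adjoint T U : Prop := forall w z,
  (dom U w /\ U w = z) <-> (forall v, dom T v -> inner z v = inner w (T v)).

Lemma is_adjoint_inner T U w v : is_adjoint T U -> dom U w -> dom T v ->
  inner (U w) v = inner w (T v).
Proof. by move=> TU Uw Tv; apply: (TU w (U w)).1. Qed.

Lemma adjointP T : right_linear T -> dense (dom T) -> is_adjoint T (adjoint T).
Proof.
move=> [_ _ Ts] dT w z; pose rep := [set x | forall v, dom T v ->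
  cinner x v = cinner w (T v)].
have repP x : rep x <-> forall v, dom T v -> inner x v = inner w (T v).
  exact: cinner_right_linear_ext.
have rep_unique x y : rep x -> rep y -> x = y.
  move=> /repP hx /repP hy; apply: (dense_inner_inj dT) => v Tv.
  by rewrite hx // hy.
split=> [[[x repx] <-]|/repP repz].
  by apply/repP; exact: (@xgetPex _ 0 rep (ex_intro _ x repx)).
have rp : rep (adjoint T w) by exact: (@xgetPex _ 0 rep (ex_intro _ z repz)).
by split; [exists z|exact: rep_unique].
Qed.

Lemma is_adjoint_right_linear T U :
  right_linear T -> is_adjoint T U -> right_linear U.
Proof.
move=> [T0 TD Ts] TU; split.
- by apply: ((TU 0 0).2 _).1 => v _; rewrite !inner0l.
- move=> v w Uv Uw; apply/TU => x Tx.
  by rewrite !innerDl !(is_adjoint_inner TU).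
- move=> v s Uv; apply/TU => x Tx; rewrite !inner_rmulC.
  by have [Txs <-] := Ts x (cconj s) Tx; rewrite (is_adjoint_inner TU).
Qed.

Lemma adjoint_total X (Y : V -> V) : right_linear X -> dom X = setT ->
  (forall w v, inner (Y w) v = inner w (X v)) ->
  dom (adjoint X) = setT /\ forall w, adjoint X w = Y w.
Proof.
move=> lX dX XY; have dd : dense (dom X).
  by rewrite dX => O [x Ox] _; exists x.
have XYP w : dom (adjoint X) w /\ adjoint X w = Y w.
  by apply/(adjointP lX dd) => v _; exact: XY.
split=> [|w]; last by have [] := XYP w.
by apply/seteqP; split=> // w _; have [] := XYP w.
Qed.

(** Von Neumann's splitting of [(w, z)] along the graph of [T]: its orthogonal
    complement consists of the pairs [(- U y, y)]. *)
Lemma closed_graph_adjoint T U w z : closed_right_linear T -> is_adjoint T U ->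
  exists u y, [/\ dom T u, z = T u + y, dom U y & w = u - U y].
Proof.
move=> [lT clT] TU; have D0 : dom T 0 by case: lT.
have [u Tu perp] := @closed_graph_decomposition _ _ _ _ w z D0
  (fun a u v Du Dv => right_linearP a lT Du Dv) clT.
have [Uy UyE] : dom U (z - T u) /\ U (z - T u) = u - w.
  apply/TU => v Tv; apply/eqP; rewrite -subr_eq0 -opprB oppr_eq0.
  by rewrite addrC -innerNl opprB perp.
by exists u, (z - T u); rewrite UyE subKr addrC subrK.
Qed.

(** If [(w, z)] is in the graph of the adjoint of [U], it is orthogonal to
    every pair [(- U y, y)], so the second part of its von Neumann splitting
    is zero and [(w, z)] lies on the graph of [T]. *)
Lemma biadjoint T U : closed_right_linear T -> is_adjoint T U -> is_adjoint U T.
Proof.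
move=> hT TU w z; split=> [[Tw <-] y Uy|wz].
  by rewrite innerC (innerC w) (is_adjoint_inner TU).
have [u [y [Tu zE Uy wE]]] := closed_graph_adjoint w z hT TU.
have := wz y Uy; rewrite zE wE innerDl innerBl (innerC (T u)).
rewrite -(is_adjoint_inner TU Uy Tu) (innerC u) !innerxx => yU.
have [|-> ->] := @norm_sqrD_eq0 _ _ (U y) y; last by rewrite subr0 addr0.
by move: (`|U y| ^+ 2) (`|y| ^+ 2) (inner (U y) u) yU => a b c *; lra.
Qed.

(** For [x] orthogonal to [dom U], the pair [(0, x)] splits as [(U y, T (U y))]
    plus [(- U y, y)].  Pairing [x = T (U y) + y] with [y] gives
    [`|U y| ^+ 2 + `|y| ^+ 2 = 0]. *)
Lemma adjoint_dense T U : closed_right_linear T -> is_adjoint T U ->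
  dense (dom U).
Proof.
move=> hT TU; have lU := is_adjoint_right_linear hT.1 TU.
apply: dense_orthogonal (right_linear_dom lU) _ => x xU.
have [u [y [Tu xE Uy uE]]] := closed_graph_adjoint 0 x hT TU.
have {}uE : U y = u by apply/esym/subr0_eq.
have := xU y Uy; rewrite xE innerDl innerC -(is_adjoint_inner TU Uy Tu) uE !innerxx.
by move=> /norm_sqrD_eq0[-> ->]; rewrite (right_linear0 hT.1) addr0.
Qed.

End RightLinearOperators.

(** * The S-resolvent set and the S-resolvents of the adjoint *)

Section SResolvent.
Variables (R : realType) (d : nat) (VR : hilbertType R).
Local Notation V := (hmodule d VR).
Variables (T U : operator V) (s : clifford R d).
Hypotheses (lT : right_linear T) (TU : is_adjoint T U) (dU : dense (dom U)).
Hypotheses (iQ : opinjective (Qop s T))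
  (bQ : bounded_right_linear (opinv (Qop s T))).

Let B := opinv (Qop s T).

Let lU : right_linear U. Proof. exact: is_adjoint_right_linear TU. Qed.

Let BK v : dom (Qop s T) (B v) /\ Qop s T (B v) = v.
Proof. by apply: opinvK; have [-> _ _] := bQ. Qed.

Let TTB v : T (T (B v)) = v + (2 * Sc s) *: T (B v) - cnormsq s *: B v.
Proof.
have [_ /= QB] := BK v; rewrite -[X in _ = X + _ - _]QB.
by rewrite addrAC addrK subrK.
Qed.

(** For [u = B v] with [v] in [dom T], the vector [T (T u)] is a combination of
    [v], [T u] and [u], all in [dom T]; so [T u] is in the domain of [Q_s[T]],
    where [Q_s[T]] sends it to [T v]. *)
Lemma inv_Qop_commute v : dom T v -> B (T v) = T (B v).
Proof.
move=> Tv; have [[TB TTBv] QB] := BK v; set u := B v in TB TTBv QB *.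
have TTu : dom T (T (T u)).
  have sT := right_linear_dom lT.
  rewrite TTB; apply: (linear_subspaceB sT); last exact: linear_subspaceZ.
  by apply: linear_subspaceD => //; exact: linear_subspaceZ.
have DTu : dom (Qop s T) (T u) by [].
rewrite -[RHS](opinvE iQ DTu) -/B; congr (B _).
rewrite -[in LHS]QB /=.
have [Du1 Tu1] := right_linearZ (2 * Sc s) lT TTBv.
have [Du2 Tu2] := right_linearB lT TTu Du1.
rewrite -[_ + cnormsq s *: u]addrC.
have [_ ->] := right_linearP (cnormsq s) lT TB Du2.
by rewrite Tu2 Tu1 addrC.
Qed.

Let linB : linear B.
Proof.
have [dB lB _] := bQ; move=> a u v.
by have [|| _ ->] := @right_linearP _ _ _ _ a u v lB; rewrite ?dB.
Qed.

Let linTB : linear (fun v => T (B v)).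
Proof.
move=> a u v; rewrite linB.
by have [_ ->] := right_linearP a lT (BK u).1.1 (BK v).1.1.
Qed.

(** The inverse of [Q_s[U]] is the bounded adjoint [B'] of [B]; with [A'] the
    bounded adjoint of [T B], [U B' = A'], and [U A'] is dual to the
    expression of [T T B] through [T B] and [B]. *)
Lemma adjoint_inv_Qop :
  [/\ opinjective (Qop s U), bounded_right_linear (opinv (Qop s U)),
      forall w v, inner (opinv (Qop s U) w) v = inner w (opinv (Qop s T) v) &
      forall w v, dom U (opinv (Qop s U) w) /\
        inner (U (opinv (Qop s U) w)) v = inner w (T (opinv (Qop s T) v))].
Proof.
have [_ _ [M BM]] := bQ.
have [B' B'P] := bounded_adjoint_exists linB BM.
have [w Uw|N AN] := @hellinger_toeplitz _ _ _ _ linTB dU.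
  exists (B' (U w)) => v; rewrite B'P; exact: (is_adjoint_inner TU Uw (BK v).1.1).
have [A' A'P] := bounded_adjoint_exists linTB AN.
have UB' w : dom U (B' w) /\ U (B' w) = A' w.
  by apply/TU => v Tv; rewrite A'P B'P inv_Qop_commute.
have UA' w : dom U (A' w) /\
    U (A' w) = w + (2 * Sc s) *: A' w - cnormsq s *: B' w.
  apply/TU => v Tv; rewrite A'P inv_Qop_commute // TTB.
  by rewrite innerBl innerDl innerBr innerDr !(innerZl, innerZr) A'P B'P.
have DQ w : dom (Qop s U) (B' w).
  by have [? UBE] := UB' w; split=> //; rewrite UBE; have [] := UA' w.
have QB' w : Qop s U (B' w) = w.
  have [_ /= ->] := UB' w; have [_ ->] := UA' w.
  by rewrite addrAC subrK addrK.
have QU v w : dom (Qop s T) v -> dom (Qop s U) w ->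
    inner (Qop s U w) v = inner w (Qop s T v).
  move=> [Tv TTv] [Uw UUw] /=.
  rewrite innerDl innerBl !innerZl innerDr innerBr !innerZr.
  by rewrite !(is_adjoint_inner TU).
have iU : opinjective (Qop s U).
  move=> w w' Dw Dw' ww'; apply: inner_inj => v.
  by have [DBv <-] := BK v; rewrite -!QU // ww'.
have BE w : opinv (Qop s U) w = B' w by rewrite -[in LHS](QB' w) opinvE.
have dB : dom (opinv (Qop s U)) = setT.
  by apply/seteqP; split=> // w _; exists (B' w).
split=> // [|w v|w v].
- split=> //; first exact/right_linear_inv/right_linear_Qop.
  exists `|M| => w; rewrite BE.
  have [->|n0] := eqVneq (B' w) 0; first by rewrite normr0 mulr_ge0.
  have np : 0 < `|B' w| by rewrite normr_gt0.
  rewrite -(ler_pM2r np) -expr2 -innerxx B'P.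
  apply: le_trans (ler_norm _) _; apply: le_trans (inner_cauchy_schwarz _ _) _.
  rewrite mulrAC [leRHS]mulrC ler_wpM2l //; apply: le_trans (BM _) _.
  by rewrite ler_wpM2r // ler_norm.
- by rewrite BE B'P.
- by rewrite BE; have [? ->] := UB' w; rewrite A'P.
Qed.

Lemma rho_S_adjoint : paravector s -> rho_S U s.
Proof. by move=> ps; have [] := adjoint_inv_Qop. Qed.

Lemma SL_resolvent_adjoint :
  opeq (SL_resolvent s U) (adjoint (SR_resolvent (cconj s) T)).
Proof.
have [iQU bQU QB QUB] := adjoint_inv_Qop.
have dBT : dom B = setT by case: bQ.
have dBU : dom (opinv (Qop s U)) = setT by case: bQU.
have -> : SR_resolvent (cconj s) T = opcomp (opsub (oplmul VR s) T) B.
  by rewrite /SR_resolvent /Qop Sc_conj cnormsq_conj cconjK.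
have [|||dA AE] := @adjoint_total _ _ _ (opcomp (opsub (oplmul VR s) T) B)
    (fun w => opinv (Qop s U) (lmulC (cconj s) w) - U (opinv (Qop s U) w)).
- apply: right_linear_comp; last by case: bQ.
  by apply: right_linear_sub => //; exact: right_linear_lmul.
- apply/seteqP; split=> // v _; split; first by rewrite dBT.
  by split=> //; have [[]] := BK v.
- by move=> w v; rewrite innerBl innerBr QB (QUB w v).2 inner_lmulC cconjK.
split=> [|w _]; last by rewrite AE.
rewrite dA; apply/seteqP; split=> // w _.
by split; split; rewrite ?dBU //; have [] := QUB w 0.
Qed.

Lemma SR_resolvent_adjoint :
  opeq (SR_resolvent s U) (adjoint (SL_resolvent (cconj s) T)).
Proof.
have [iQU bQU QB QUB] := adjoint_inv_Qop.
have dBT : dom B = setT by case: bQ.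
have dBU : dom (opinv (Qop s U)) = setT by case: bQU.
have lB : right_linear B by case: bQ.
have -> : SL_resolvent (cconj s) T =
    opsub (opcomp B (oplmul VR s)) (opcomp T B).
  by rewrite /SL_resolvent /Qop Sc_conj cnormsq_conj cconjK.
have [|||dA AE] := @adjoint_total _ _ _
    (opsub (opcomp B (oplmul VR s)) (opcomp T B))
    (fun w => lmulC (cconj s) (opinv (Qop s U) w) - U (opinv (Qop s U) w)).
- apply: right_linear_sub; apply: right_linear_comp => //.
  exact: right_linear_lmul.
- apply/seteqP; split=> // v _.
  by split; split; rewrite ?dBT //; have [[]] := BK v.
- by move=> w v; rewrite innerBl innerBr (QUB w v).2 inner_lmulC cconjK QB.
split=> [|w _]; last by rewrite AE.
rewrite dA; apply/seteqP; split=> // w _; split; first by rewrite dBU.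
by split=> //; have [] := QUB w 0.
Qed.

End SResolvent.

Theorem theorem3p5 (R : realType) (d : nat) (hd : (0 < d)%N)
    (VR : hilbertType R) (T : operator (hmodule d VR))
    (hT : closed_right_linear T) (hdense : dense (dom T)) :
  sigma_S (adjoint T) = sigma_S T /\
  forall s : clifford R d, rho_S (adjoint T) s ->
    opeq (SL_resolvent s (adjoint T)) (adjoint (SR_resolvent (cconj s) T)) /\
    opeq (SR_resolvent s (adjoint T)) (adjoint (SL_resolvent (cconj s) T)).
Proof.
have [lT _] := hT; have TU := adjointP lT hdense.
have UT := biadjoint hT TU.
have lU := is_adjoint_right_linear lT TU.
have dU := adjoint_dense hT TU.
have rhoE : rho_S (adjoint T) = rho_S T.
  apply/seteqP; split=> s [ps [iQ bQ]].
    exact: (rho_S_adjoint lU UT hdense).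
  exact: (rho_S_adjoint lT TU dU).
rewrite /sigma_S rhoE; split=> // s [_ [iQ bQ]].
by split; [exact: SL_resolvent_adjoint|exact: SR_resolvent_adjoint].
Qed.
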